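(* Let $q=2^s$ with $s\ge 1$. Let $\Gamma\subset\{1,\dots,q-1\}$ be a set of representatives (the smallest element of each) of the 2-cyclotomic cosets in $\{1,\dots,q-1\}$, let $c_0\in\mathbb F_2$ and, for each $i\in\Gamma$, let $c_i\in\mathbb F_{2^{\ell_i}}$, with at least one $c_i\ne0$ ($i\in\Gamma$). Let $$f(\gamma)=c_0+\sum_{i\in\Gamma}\mathrm{tr}_{\mathbb F_{2^{\ell_i}}/\mathbb F_2}(c_i\gamma^i),\qquad \gamma\in\mathbb F_q .$$ Then the single-qudit real-phase gate $|\gamma\rangle\mapsto(-1)^{f(\gamma)}|\gamma\rangle$ lies in exactly the $D$-th level of the Clifford hierarchy, where $$D=\max_{i\in\Gamma,\;c_i\neq0}\mathrm{wt}(i),$$ meaning that it lies in level $D$ but not in any lower level.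
   Context: $\mathrm{wt}(i)$ is the Hamming weight of the binary expansion of the integer $i$. For $i\in\{1,\dots,q-1\}$, the 2-cyclotomic coset of $i$ is $C_i=\{i,2i,4i,\dots,2^{\ell_i-1}i\}$ reduced modulo $q-1$, with $\ell_i=\min\{j\ge1: 2^ji\equiv i \bmod (q-1)\}$; residues are taken in $\{1,\dots,q-1\}$, so that $q-1$ forms its own coset with $\ell_{q-1}=1$. One has $\ell_i\mid s$ and $\gamma^i\in\mathbb F_{2^{\ell_i}}$ for all $\gamma\in\mathbb F_q$, so the traces make sense, with $\mathrm{tr}_{\mathbb F_{2^\ell}/\mathbb F_2}(x)=x+x^2+\dots+x^{2^{\ell-1}}$. Every function $\mathbb F_q\to\mathbb F_2$ can be written uniquely in the form $\gamma\mapsto c_0+\sum_{i\in\Gamma}\mathrm{tr}_{\mathbb F_{2^{\ell_i}}/\mathbb F_2}(c_i\gamma^i)$ with $c_0\in\mathbb F_2$ and $c_i\in\mathbb F_{2^{\ell_i}}$ for $i\in\Gamma$ (allowing all $c_i=0$). A Galois qudit of dimension $q=2^s$ has basis $\{|\gamma\rangle:\gamma\in\mathbb F_q\}$ and is identified with $s$ qubits by choosing an $\mathbb F_2$-basis $(\alpha_j)$ of $\mathbb F_q$ and setting $|\sum_j b_j\alpha_j\rangle=|b_1\rangle\cdots|b_s\rangle$; the level does not depend on the choice of basis. Clifford hierarchy on $s$ qubits: level 1 is the Pauli group (with global phases), and for $t\ge2$ level $t$ is the set of unitaries $U$ such that $UPU^\dagger$ lies in level $t-1$ for every Pauli $P$.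 *)

(* Defs.v *)
From mathcomp Require Import all_boot all_order all_algebra all_field.
From mathcomp Require Import sesquilinear spectral.

Set Implicit Arguments.
Unset Strict Implicit.
Unset Printing Implicit Defensive.

Import Order.TTheory GRing.Theory Num.Theory.
Local Open Scope ring_scope.

Section CyclotomicCosets.
Local Open Scope nat_scope.

(* The bits of i at positions >= i vanish since i < 2 ^ i. *)
Definition wt (i : nat) : nat := \sum_(j < i) odd (i %/ 2 ^ j).

(* Residue modulo 2 ^ s - 1 taken in {1, ..., 2 ^ s - 1} (for s >= 1). *)
Definition residue (s n : nat) : nat :=
  if n %% (2 ^ s - 1) == 0 then 2 ^ s - 1 else n %% (2 ^ s - 1).

(* The least j >= 1 with 2 ^ j * i = i modulo 2 ^ s - 1; as j = s always
   qualifies (for s >= 1), the search is restricted to j <= s. *)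
Definition coset_length (s i : nat) : nat :=
  [arg min_(j < (ord_max : 'I_s.+1)
           | (0 < j) && (2 ^ j * i == i %[mod 2 ^ s - 1])) (j : nat)].

Definition cyclotomic_coset (s i : nat) : seq nat :=
  [seq residue s (2 ^ j * i) | j <- iota 0 (coset_length s i)].

Definition coset_leader (s i : nat) : bool :=
  [&& 0 < i, i < 2 ^ s & all (leq i) (cyclotomic_coset s i)].

End CyclotomicCosets.

Section FieldTrace.
Variable F : fieldExtType 'F_2.

(* x lies in the subfield of F with 2 ^ l elements. *)
Definition in_subfield_2exp (l : nat) (x : F) : Prop :=
  exists2 K : {subfield F}, #|(K : {vspace finvect_type F})| = (2 ^ l)%N & x \in K.

Definition trace2 (l : nat) (x : F) : F := \sum_(k < l) x ^+ (2 ^ k).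

End FieldTrace.

Section Qubits.
Local Open Scope sesquilinear_scope.
Variables (C : numClosedFieldType) (s : nat).

(* b : bits labels the computational basis state |b_1> ... |b_s>; operators on
   s qubits are matrices whose rows and columns are enumerated by bits. *)
Definition bits : finType := {ffun 'I_s -> 'F_2}.
Definition operator : Type := 'M[C]_#|bits|.

Definition pauli_I : 'M[C]_2 := 1%:M.
Definition pauli_X : 'M[C]_2 := \matrix_(i, j) (i != j)%:R.
Definition pauli_Z : 'M[C]_2 := \matrix_(i, j) ((i == j)%:R * (-1) ^+ i).
Definition pauli_Y : 'M[C]_2 := 'i *: (pauli_X *m pauli_Z).

Definition tensor (A : 'I_s -> 'M[C]_2) : operator :=
  \matrix_(u, v) \prod_j A j ((enum_val u : bits) j) ((enum_val v : bits) j).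

(* Arbitrary global phases are allowed. *)
Definition pauli (P : operator) : Prop :=
  exists (w : C) (A : 'I_s -> 'M[C]_2),
    [/\ `|w| = 1,
        forall j, A j \in [:: pauli_I; pauli_X; pauli_Y; pauli_Z]
      & P = w *: tensor A].

(* Levels start at 1; level 0 is empty by convention. *)
Fixpoint clifford_level (t : nat) (U : operator) : Prop :=
  match t with
  | 0 => False
  | 1 => pauli U
  | t'.+1 => U \is unitarymx /\
             forall P, pauli P -> clifford_level t' (U *m P *m U^t*)
  end.

End Qubits.

Section PhaseGate.
Variables (C : numClosedFieldType) (s : nat) (F : fieldExtType 'F_2).

(* The qudit basis label g = \sum_j b_j alpha_j encoded by the bits b. *)
Definition qudit_of_bits (alpha : s.-tuple F) (b : bits s) : F :=
  \sum_(j < s) b j *: tnth alpha j.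

Definition phase_gate (alpha : s.-tuple F) (f : F -> 'F_2) : operator C s :=
  diag_mx (\row_u (-1) ^+ f (qudit_of_bits alpha (enum_val u))).

End PhaseGate.

(* Main.v *)
(* The degree of a function between abelian groups is measured by iterated finite
   differences: f has degree at most 0 if it is constant, and at most d+1 if all
   x |-> f (x + a) - f x have degree at most d.

   Conjugating the Pauli operator sending |v> to (-1)^{l(v)} |v + b> by the phase
   gate (-1)^h yields |v> |-> (-1)^{h(v + b) - h(v) + l(v)} |v + b>.  Since l is
   affine, induction on t shows that (-1)^h is in level t exactly when h has
   degree at most t.

   On the field side, x^i is a product of wt(i) additive maps x^(2^j), hence has
   degree at most wt(i).  Conversely let p have size at most q and degree at most d
   as a function.  The x^j coefficient of p(x + a) - p(x) is a polynomial in a of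
   size at most q, which vanishes at every a when wt(j) >= d (induction on d).
   Choosing j with wt(j) = wt(i) - 1 and 'C(i, j) odd, the coefficient of a^(i - j)
   shows that p`_i = 0 whenever wt(i) > d.  Distinct terms (c_i x^i)^(2^k) of the
   trace expansion reduce to distinct monomials, so c_i is the x^i coefficient of
   the reduced polynomial. *)

Require Import Defs.
From mathcomp Require Import all_boot all_order all_algebra all_field.
From mathcomp Require Import reals complex.
From mathcomp Require Import zify ring.

Set Implicit Arguments.
Unset Strict Implicit.
Unset Printing Implicit Defensive.

Import Order.TTheory GRing.Theory Num.Theory.
Local Open Scope ring_scope.

(** * Degree of maps between abelian groups through finite differences *)

Fixpoint deriv_deg_le (V W : zmodType) (d : nat) (f : V -> W) : Prop :=
  match d with
  | 0 => forall x y, f x = f y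
  | d'.+1 => forall a, deriv_deg_le d' (fun x => f (x + a) - f x)
  end.

Section DerivDeg.
Variables V W : zmodType.
Implicit Types (f g : V -> W) (d : nat).

Lemma eq_deriv_deg_le d f g :
  f =1 g -> deriv_deg_le d f -> deriv_deg_le d g.
Proof.
elim: d f g => [|d IH] f g fg /= fd; first by move=> x y; rewrite -!fg.
by move=> a; apply: IH (fd a) => x; rewrite !fg.
Qed.

Lemma deriv_deg_leW d f : deriv_deg_le d f -> deriv_deg_le d.+1 f.
Proof.
elim: d f => [|d IH] f /= fd a; last exact: IH (fd a).
by move=> x y; rewrite (fd (x + a) x) (fd (y + a) y) !subrr.
Qed.

Lemma deriv_deg_le_leq d e f :
  (d <= e)%N -> deriv_deg_le d f -> deriv_deg_le e f.
Proof.
move=> /subnKC <- fd; elim: (e - d)%N => [|k IH]; first by rewrite addn0.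
by rewrite addnS; apply: deriv_deg_leW.
Qed.

Lemma deriv_deg_le_cst d (w : W) : deriv_deg_le d (fun _ : V => w).
Proof. by apply: (@deriv_deg_le_leq 0). Qed.

Lemma deriv_deg_leD d f g :
  deriv_deg_le d f -> deriv_deg_le d g -> deriv_deg_le d (fun x => f x + g x).
Proof.
elim: d f g => [|d IH] f g /= fd gd; first by move=> x y; rewrite (fd x y) (gd x y).
move=> a; apply: eq_deriv_deg_le (IH _ _ (fd a) (gd a)) => x.
by rewrite opprD addrACA.
Qed.

Lemma deriv_deg_le_sum (I : Type) (r : seq I) (P : pred I) d (F : I -> V -> W) :
  (forall i, P i -> deriv_deg_le d (F i)) ->
  deriv_deg_le d (fun x => \sum_(i <- r | P i) F i x).
Proof.
move=> Fd; elim: r => [|i r IH].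
  apply: eq_deriv_deg_le (deriv_deg_le_cst d 0) => x.
  by rewrite big_nil.
case Pi: (P i); last by apply: eq_deriv_deg_le IH => x; rewrite big_cons Pi.
by apply: eq_deriv_deg_le (deriv_deg_leD (Fd i Pi) IH) => x; rewrite big_cons Pi.
Qed.

Lemma deriv_deg_le_shift d f b :
  deriv_deg_le d f -> deriv_deg_le d (fun x => f (x + b)).
Proof.
elim: d f => [|d IH] f /= fd; first by move=> x y; apply: fd.
by move=> a; apply: eq_deriv_deg_le (IH _ (fd a)) => x; rewrite addrAC.
Qed.

End DerivDeg.

Section Composition.
Variables V W : zmodType.
Implicit Types (f : V -> W) (d : nat).

Lemma deriv_deg_le_comp (W' : zmodType) (h : W -> W') d f :
  {morph h : x y / x - y} -> deriv_deg_le d f -> deriv_deg_le d (h \o f).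
Proof.
move=> hB; elim: d f => [|d IH] f /= fd; first by move=> x y; rewrite (fd x y).
by move=> a; apply: eq_deriv_deg_le (IH _ (fd a)) => x /=; rewrite hB.
Qed.

Lemma deriv_deg_le_comp_inj (W' : zmodType) (h : W -> W') d f :
  {morph h : x y / x - y} -> injective h ->
  deriv_deg_le d (h \o f) -> deriv_deg_le d f.
Proof.
move=> hB hI; elim: d f => [|d IH] f /= fd.
  by move=> x y; apply/hI/fd.
move=> a; apply: IH; apply: eq_deriv_deg_le (fd a) => x /=.
by rewrite hB.
Qed.

Lemma deriv_deg_le_precomp (V' : zmodType) (h : V' -> V) d f :
  {morph h : x y / x + y} -> deriv_deg_le d f -> deriv_deg_le d (f \o h).
Proof.
move=> hD; elim: d f => [|d IH] f /= fd; first by move=> x y; apply: fd.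
by move=> a; apply: eq_deriv_deg_le (IH _ (fd (h a))) => x /=; rewrite hD.
Qed.

(** The section [k] lifts each direction [a] to [k a]; additivity is asked of [h] alone. *)
Lemma deriv_deg_le_precomp_surj (V' : zmodType) (h : V' -> V) (k : V -> V') d f :
  {morph h : x y / x + y} -> cancel k h ->
  deriv_deg_le d (f \o h) -> deriv_deg_le d f.
Proof.
move=> hD kK; elim: d f => [|d IH] f /= fd.
  by move=> x y; rewrite -(kK x) -(kK y); apply: fd.
move=> a; apply: IH; apply: eq_deriv_deg_le (fd (k a)) => x /=.
by rewrite hD kK.
Qed.

End Composition.

(** Leibniz rule: the difference is [x * (u (x + a) - u x) + a * u (x + a)], and both summands have
    degree at most [d]. *)
Lemma deriv_deg_le_mulX (L : comNzRingType) d (u : L -> L) :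
  deriv_deg_le d u -> deriv_deg_le d.+1 (fun x => x * u x).
Proof.
elim: d u => [|d IH] u ud a.
  by move=> x y; rewrite (ud (x + a) y) (ud x y) (ud (y + a) y); ring.
have au : deriv_deg_le d.+1 (fun x => a * u (x + a)).
  apply: (@deriv_deg_le_comp _ _ _ ( *%R a)); first by move=> x y; rewrite mulrBr.
  exact: deriv_deg_le_shift.
apply: eq_deriv_deg_le (deriv_deg_leD (IH _ (ud a)) au) => x.
by rewrite mulrBr mulrDl addrAC.
Qed.

(** * Binary weight *)

Section BinaryWeight.
Local Open Scope nat_scope.

(** The sum in [wt] has a range that depends on its argument; a common range makes two weights
    comparable. *)
Lemma wt_widen i n : i <= n -> wt i = \sum_(j < n) odd (i %/ 2 ^ j).
Proof.
move=> le_in; rewrite /wt -!(big_mkord xpredT (fun j => nat_of_bool (odd (i %/ 2 ^ j)))).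
rewrite [RHS](big_cat_nat (n := i)) //= [X in _ = _ + X](_ : _ = 0) ?addn0 //.
rewrite big_nat_cond big1 // => j; rewrite andbT => /andP[ij _].
by rewrite divn_small // (leq_ltn_trans ij) // ltn_expl.
Qed.

Lemma wtS_double (b : bool) n : wt (b + n.*2) = b + wt n.
Proof.
rewrite (@wt_widen _ (n.*2.+1)); last by case: b.
rewrite big_ord_recl /= expn0 divn1 oddD odd_double addbF oddb.
congr (_ + _); rewrite (@wt_widen n n.*2); last by rewrite -addnn leq_addr.
by apply: eq_bigr => j _; rewrite /= expnS divnMA divn2 half_bit_double.
Qed.

Lemma wt_double n : wt n.*2 = wt n.
Proof. exact: (wtS_double false). Qed.

Lemma wt_doubleS n : wt n.*2.+1 = (wt n).+1.
Proof. exact: (wtS_double true). Qed.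

Lemma wt_gt0 n : 0 < n -> 0 < wt n.
Proof.
elim/ltn_ind: n => n IH n0; rewrite -(odd_double_half n) wtS_double.
case on: (odd n); rewrite // add0n IH //; first by lia.
by move: n0 on; case: n {IH} => [|[]].
Qed.

End BinaryWeight.

(** * Degree and coefficients of polynomial functions in characteristic 2 *)

Section PolynomialFunctions.

(** Induction on binary digits: a factor [x] accounts for a low bit 1, and squaring, additive in
    characteristic 2, preserves the degree bound. *)
Lemma deriv_deg_le_expn (L : comNzRingType) (pchar2 : 2%N \in [pchar L]) (i : nat) :
  deriv_deg_le (wt i) (fun x : L => x ^+ i).
Proof.
elim/ltn_ind: i => -[|i] IH; first by apply: deriv_deg_le_cst.
rewrite -(odd_double_half i.+1); case oi: (odd i.+1).
  rewrite add1n wt_doubleS -wt_double.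
  have lt_i : ((i.+1)./2.*2 < i.+1)%N by have := odd_double_half i.+1; rewrite oi; lia.
  by apply: eq_deriv_deg_le (deriv_deg_le_mulX (IH _ lt_i)) => x; rewrite -exprS.
rewrite add0n wt_double.
have lt_i : ((i.+1)./2 < i.+1)%N by lia.
apply: eq_deriv_deg_le (deriv_deg_le_comp (h := pFrobenius_aut pchar2) _ (IH _ lt_i)).
  by move=> x /=; rewrite pFrobenius_autE -exprM muln2.
exact: raddfB.
Qed.

(** Compare the coefficients of [X^(2j)] in [(X + 1)^(2n) = (X^2 + 1)^n] over ['F_2]. *)
Lemma odd_bin_double n j : odd 'C(n.*2, j.*2) = odd 'C(n, j).
Proof.
have coefE m k : (('X + 1) ^+ m : {poly 'F_2})`_k = 'C(m, k)%:R.
  rewrite addrC exprDn coef_sum; under eq_bigr => i _.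
    rewrite expr1n mul1r coefMn coefXn; over.
  case: (ltnP k m.+1) => [lt_km|le_mk].
    rewrite (bigD1 (Ordinal lt_km)) //= eqxx big1 ?addr0 //.
    by move=> i; rewrite -val_eqE eq_sym /= => /negPf ->; rewrite mul0rn.
  rewrite bin_small // big1 // => i _.
  by rewrite gtn_eqF ?mul0rn // (leq_trans (ltn_ord i)).
have oddE m : odd m = (m%:R != 0 :> 'F_2).
  by rewrite -val_eqE /= val_Fp_nat // modn2; case: (odd m).
have pchar2 : 2%N \in [pchar {poly 'F_2}] by rewrite pchar_poly pchar_Fp.
rewrite !oddE -!coefE -muln2 mulnC exprM.
have -> : ('X + 1) ^+ 2 = ('X + 1) \Po 'X^2 :> {poly 'F_2}.
  rewrite comp_polyD comp_polyX comp_polyC -(pFrobenius_autE pchar2) raddfD /=.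
  by rewrite !pFrobenius_autE expr1n.
by rewrite -rmorphXn /= coef_comp_poly_Xn // -muln2 dvdn_mull // mulnK.
Qed.

(** The witness is [i] with its lowest set bit cleared. *)
Lemma wt_pred_odd_bin i : (0 < i)%N ->
  exists j, [/\ (j < i)%N, wt i = (wt j).+1 & odd 'C(i, j)].
Proof.
elim/ltn_ind: i => i IH i0; rewrite -(odd_double_half i).
case oi: (odd i).
  exists (i./2.*2); rewrite add1n wt_doubleS wt_double ltnSn binSn.
  by rewrite oddS odd_double.
have hi : i./2.*2 = i by rewrite -[RHS]odd_double_half oi.
have [j [lt_j wt_j odd_j]] : exists j, [/\ (j < i./2)%N, wt i./2 = (wt j).+1 & odd 'C(i./2, j)].
  by apply: IH; lia.
by exists j.*2; rewrite add0n ltn_double !wt_double odd_bin_double.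
Qed.

Lemma size_nderivn_le (L : nzSemiRingType) (p : {poly L}) n : (size p^`N(n) <= size p)%N.
Proof.
apply/leq_sizeP => j le_pj; rewrite coef_nderivn nth_default ?mul0rn //.
by rewrite (leq_trans le_pj) ?leq_addl.
Qed.

Variable L : finFieldType.
Implicit Types p : {poly L}.

Lemma horner_eq0_finField p : (size p <= #|L|)%N -> (forall x, p.[x] = 0) -> p = 0.
Proof.
move=> sz_p p0; apply/eqP; apply: contraTT sz_p => /max_poly_roots/(_ (_ : all _ (enum L))).
rewrite -ltnNge -cardE enum_uniq; apply=> //.
by apply/allP => x _; apply/rootP.
Qed.

Lemma horner_cst_finField p (w : L) :
  (0 < #|L|)%N -> (size p <= #|L|)%N -> (forall x, p.[x] = w) -> p = w%:P.
Proof.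
move=> L0 sz_p pw; apply/eqP; rewrite -subr_eq0; apply/eqP/horner_eq0_finField.
  apply: leq_trans (size_polyD _ _) _; rewrite size_polyN geq_max sz_p.
  by rewrite (leq_trans (size_polyC_leq1 _)).
by move=> x; rewrite !hornerE pw subrr.
Qed.

Lemma deriv_deg_le_coef0 (pchar2 : 2%N \in [pchar L]) d p :
  (size p <= #|L|)%N -> deriv_deg_le d (fun x => p.[x]) ->
  forall i, (d < wt i)%N -> p`_i = 0.
Proof.
have L0 : (0 < #|L|)%N by apply/card_gt0P; exists 0.
elim: d p => [|d IH] p sz_p deg_p i lt_di.
  have i0 : i != 0%N by apply: contraTneq lt_di => ->; rewrite /wt big_ord0.
  by rewrite (horner_cst_finField L0 sz_p (fun x => deg_p x 0)) coefC (negPf i0).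
have [|j [lt_ji wt_i odd_ij]] := @wt_pred_odd_bin i.
  by case: i lt_di => //; rewrite /wt big_ord0.
have [le_pj|lt_jp] := leqP (size p) j.
  by rewrite nth_default // (leq_trans le_pj) // ltnW.
(* By Taylor expansion [r] represents [p(x + a) - p(x)], whose coefficient at [j] vanishes by
   induction; so the Hasse derivative of order [j] is a constant function. *)
have Nj a : (p^`N(j)).[a] = p`_j.
  pose r := \poly_(k < size p) ((p^`N(k)).[a] - p`_k).
  have rE x : r.[x] = p.[x + a] - p.[x].
    rewrite horner_poly [x + a]addrC nderiv_taylor; last exact: mulrC.
    rewrite [p.[x]]horner_coef -sumrB; apply: eq_bigr => k _.
    by rewrite mulrBl.
  have sz_r : (size r <= #|L|)%N by apply: leq_trans (size_poly _ _) sz_p.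
  have lt_dj : (d < wt j)%N by rewrite wt_i ltnS in lt_di.
  have := IH r sz_r (eq_deriv_deg_le (fun x => esym (rE x)) (deg_p a)) j lt_dj.
  by rewrite coef_poly lt_jp => /eqP; rewrite subr_eq0 => /eqP.
(* A constant polynomial has coefficient 0 at [i - j > 0]; here it is the coefficient of [p] at [i]
   times ['C(i, j)], which is 1 in characteristic 2. *)
have := congr1 (fun r : {poly L} => r`_(i - j))
  (horner_cst_finField L0 (leq_trans (size_nderivn_le p j) sz_p) Nj).
rewrite coefC coef_nderivn subnKC 1?ltnW // subn_eq0 leqNgt lt_ji /=.
rewrite -mulr_natr -[('C(i, j))%:R]/('C(i,j)%:R : L).
by rewrite -(odd_double_half 'C(i, j)) odd_ij natrD -muln2 natrM (pcharf0 pchar2) mulr0 addr0 mulr1.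
Qed.

End PolynomialFunctions.

(** * 2-cyclotomic cosets and their leaders *)

Section CyclotomicCosets.
Local Open Scope nat_scope.
Variable s : nat.
Hypothesis s_gt0 : 0 < s.
Let N := 2 ^ s - 1.

Let N_gt0 : 0 < N.
Proof. by rewrite subn_gt0 -{1}(expn0 2) ltn_exp2l. Qed.

Lemma mul_exp2_mod i : 2 ^ s * i = i %[mod 2 ^ s - 1].
Proof.
have -> : 2 ^ s = N + 1 by rewrite subnK // expn_gt0.
by rewrite mulnDl mul1n mulnC addnK modnMDl.
Qed.

Lemma coset_lengthP i :
  [/\ 0 < coset_length s i,
      coset_length s i <= s,
      2 ^ coset_length s i * i = i %[mod 2 ^ s - 1]
    & forall j, 0 < j < coset_length s i -> 2 ^ j * i != i %[mod 2 ^ s - 1]].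
Proof.
rewrite /coset_length; case: arg_minnP => [|l /andP[l0 /eqP il] l_min].
  (* The default [s] of the [arg min] satisfies the predicate, so the minimum is genuine. *)
  by rewrite s_gt0 /= mul_exp2_mod.
split=> // [|j /andP[j0 lt_jl]]; first by rewrite -ltnS.
apply: contraL lt_jl => ij; rewrite -leqNgt.
have [le_js|lt_sj] := leqP j s; last by rewrite (leq_trans _ (ltnW lt_sj)) // -ltnS.
by apply: (l_min (Ordinal (le_js : j < s.+1))); rewrite j0.
Qed.

Lemma residue_mod n : residue s n = n %[mod 2 ^ s - 1].
Proof. by rewrite /residue; case: eqP => [->|_]; rewrite ?modnn ?modn_mod. Qed.

Lemma residue_bounds n : 0 < residue s n < 2 ^ s.
Proof.
have lt_N : N < 2 ^ s by rewrite /N subn1 prednK ?expn_gt0.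
rewrite /residue -/N; case: eqP => [_|/eqP]; rewrite ?N_gt0 ?lt_N // -lt0n => ->.
by rewrite (ltn_trans _ lt_N) ?ltn_mod.
Qed.

Lemma eq_residue m n : m = n %[mod 2 ^ s - 1] -> residue s m = residue s n.
Proof. by rewrite /residue => ->. Qed.

Lemma residue_id i : 0 < i < 2 ^ s -> residue s i = i.
Proof.
move=> /andP[i0 lt_i]; rewrite /residue -/N.
have : i <= N by rewrite -ltnS /N subn1 prednK ?expn_gt0.
rewrite leq_eqVlt => /predU1P[->|lt_iN]; first by rewrite modnn.
by rewrite modn_small // gtn_eqF.
Qed.

(** Multiplying by [2 ^ l], for [l] the coset length, fixes [i] modulo [2 ^ s - 1], so only [m %% l]
    matters. *)
Lemma residue_in_coset i m : residue s (2 ^ m * i) \in cyclotomic_coset s i.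
Proof.
have [l0 _ li _] := coset_lengthP i; set l := coset_length s i in l0 li *.
apply/mapP; exists (m %% l); first by rewrite mem_iota ltn_mod.
apply: eq_residue; rewrite {1}(divn_eq m l) addnC expnD -mulnA.
apply/eqP; rewrite -modnMmr; apply/eqP; rewrite -[RHS]modnMmr.
congr ((_ * _) %% _); elim: (m %/ l) => [|k IH]; first by rewrite mul1n.
by rewrite mulSn expnD -mulnA -modnMmr IH modnMmr.
Qed.

(** This separates the monomials of the trace expansion. Both leaders lie in one coset, so they are
    equal, and [k > 0] would contradict the minimality of the coset length. *)
Lemma coset_leader_residue i i' k :
  coset_leader s i -> coset_leader s i' -> k < coset_length s i' ->
  residue s (2 ^ k * i') = i -> i = i' /\ k = 0.
Proof.
move=> /and3P[i0 lt_i /allP min_i] /and3P[i'0 lt_i' /allP min_i'] lt_k ri.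
have [_ _ il' l'_min] := coset_lengthP i'; set l := coset_length s i' in lt_k il' l'_min.
have le_i'i : i' <= i by rewrite -ri min_i' // residue_in_coset.
have i_mod : i = 2 ^ k * i' %[mod 2 ^ s - 1] by rewrite -ri residue_mod.
have le_ii' : i <= i'.
  (* Doubling [l - k] more times closes the cycle and leads from [i] back to [i']. *)
  have <- : residue s (2 ^ (l - k) * i) = i'.
    rewrite -[RHS]residue_id ?i'0 //; apply: eq_residue.
    by rewrite -modnMmr i_mod modnMmr mulnA -expnD subnK // ltnW.
  by rewrite min_i // residue_in_coset.
have eq_i : i = i' by apply/eqP; rewrite eqn_leq le_i'i le_ii'.
split=> //; apply/eqP; rewrite -leqn0 leqNgt; apply/negP => k0.
by have := l'_min k; rewrite k0 lt_k -i_mod eq_i eqxx => /(_ isT).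
Qed.

End CyclotomicCosets.

(** * Monomial operators and the Clifford hierarchy *)

Section MonomialOperators.
Local Open Scope sesquilinear_scope.
Variables (C : numClosedFieldType) (s : nat).

(* [bits s] is a bare finType; this convertible type carries the group structure. *)
Local Notation V := {ffun 'I_s -> 'F_2}.
Implicit Types (a b v : V) (phi psi : V -> C) (h l : V -> 'F_2).

(** A diagonal matrix followed by the bit flip by [a]. This class contains Paulis and phase gates
    and is closed under products and adjoints, so conjugation becomes a computation on [a] and
    [phi]. *)
Definition monomial_op a phi : operator C s :=
  \matrix_(u, v) (((enum_val u : V) == (enum_val v : V) + a)%:R * phi (enum_val v)).

Lemma eq_monomial_op a phi psi : phi =1 psi -> monomial_op a phi = monomial_op a psi.
Proof. by move=> eq_phi; apply/matrixP => u v; rewrite !mxE eq_phi. Qed.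

Lemma addF2 (x : 'F_2) : x + x = 0.
Proof. by case: x => -[|[|x]] //= ?; apply/val_inj. Qed.

Lemma addbb a : a + a = 0.
Proof. by apply/ffunP => j; rewrite !ffunE addF2. Qed.

Lemma addbK a v : v + a + a = v.
Proof. by rewrite -addrA addbb addr0. Qed.

Lemma mul_monomial_op a b phi psi :
  monomial_op a phi *m monomial_op b psi =
  monomial_op (a + b) (fun v => phi (v + b) * psi v).
Proof.
apply/matrixP => u v; rewrite !mxE.
rewrite (bigD1 (enum_rank (enum_val v + b : bits s))) //= big1 ?addr0 => [|w ne_w].
  by rewrite !mxE enum_rankK eqxx mul1r -addrA [b + a]addrC mulrA.
rewrite !mxE [(enum_val w == _)%B](_ : _ = false) ?mul0r ?mulr0 //.
by apply: contraNF ne_w => /eqP <-; rewrite enum_valK.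
Qed.

Lemma adj_monomial_op a phi :
  (monomial_op a phi)^t* = monomial_op a (fun v => (phi (v + a))^*).
Proof.
apply/matrixP => u v; rewrite !mxE rmorphM rmorph_nat.
have -> : (enum_val v == enum_val u + a :> V) = (enum_val u == enum_val v + a :> V).
  by apply/eqP/eqP => ->; rewrite addbK.
by case: eqP => [->|_]; rewrite ?mul0r // addbK.
Qed.

Lemma monomial_op1 : monomial_op 0 (fun => 1) = 1%:M.
Proof. by apply/matrixP => u v; rewrite !mxE addr0 (inj_eq enum_val_inj) mulr1. Qed.

Lemma monomial_op_unitary a phi :
  (forall v, `|phi v| = 1) -> monomial_op a phi \is unitarymx.
Proof.
move=> phi1; apply/unitarymxP; rewrite adj_monomial_op mul_monomial_op addbb.
rewrite -monomial_op1; apply: eq_monomial_op => v.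
by rewrite -normCK phi1 expr1n.
Qed.

Lemma monomial_op_inj a b phi psi :
  (forall v, phi v != 0) -> monomial_op a phi = monomial_op b psi ->
  a = b /\ phi =1 psi.
Proof.
move=> phi0 /matrixP eq_op.
have E v : phi v = (v + a == v + b)%:R * psi v.
  have := eq_op (enum_rank (v + a : bits s)) (enum_rank (v : bits s)).
  by rewrite !mxE !enum_rankK eqxx mul1r.
have eq_ab : a = b.
  by apply/eqP; have := phi0 0; apply: contraNT => /negPf ab; rewrite E !add0r ab mul0r.
by split=> // v; rewrite E eq_ab eqxx mul1r.
Qed.

Lemma signF2D (x y : 'F_2) : (-1) ^+ (x + y)%R = (-1) ^+ x * (-1) ^+ y :> C.
Proof. by rewrite -exprD -signr_odd [RHS]/= -[RHS]signr_odd /= modn2 oddb. Qed.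

Lemma signF2_inj : injective (fun x : 'F_2 => (-1) ^+ x : C).
Proof.
move=> x y /=; rewrite -signr_odd -[RHS]signr_odd => /signr_inj.
by move: x y => [[|[|x]] //= ?] [[|[|y]] //= ?] // _; apply/val_inj.
Qed.

Lemma signF2_sum (I : Type) (r : seq I) (F : I -> 'F_2) :
  (-1) ^+ (\sum_(i <- r) F i)%R = \prod_(i <- r) (-1) ^+ (F i) :> C.
Proof.
elim: r => [|i r IH]; first by rewrite !big_nil.
by rewrite !big_cons signF2D IH.
Qed.

Definition phased_op a (w : C) h := monomial_op a (fun v => w * (-1) ^+ h v).

Definition bit_unit (j : 'I_s) : V := [ffun k => (k == j)%:R].

Lemma bits_sum v : v = \sum_j (if v j == 0 then 0 else bit_unit j).
Proof.
apply/ffunP => k; rewrite sum_ffunE (bigD1 k) //= big1 => [|j jk].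
  rewrite addr0; case: ifP => [/eqP ->|]; rewrite !ffunE ?eqxx //.
  by case: (v k) => -[|[|x]] //= ? _; apply/val_inj.
by case: ifP => _; rewrite !ffunE // eq_sym (negPf jk).
Qed.

(** [l - l 0] is additive, hence determined by its values on the unit vectors. *)
Lemma deriv_deg_le1_affine l : deriv_deg_le 1 l ->
  forall v, l v = l 0 + \sum_j (l (bit_unit j) - l 0) * v j.
Proof.
move=> l1.
pose m v := l v - l 0.
have mD : {morph m : u v / u + v}.
  by move=> u v; have /= := l1 v u 0; rewrite add0r /m => /eqP; rewrite subr_eq => /eqP ->; ring.
have m0 : m 0 = 0 by rewrite /m subrr.
move=> v; apply/eqP; rewrite addrC -subr_eq -/(m v) {1}[v]bits_sum (big_morph m mD m0).
apply/eqP/eq_bigr => j _; case: ifP => [/eqP ->|]; first by rewrite m0 mulr0.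
by case: (v j) => -[|[|x]] //= lt_x _; rewrite (_ : Ordinal lt_x = 1) ?mulr1 //; apply/val_inj.
Qed.


Lemma deriv_deg_le1_linear (b : V) : deriv_deg_le 1 (fun v : V => \sum_j b j * v j).
Proof.
move=> a /= u v; rewrite -!sumrB; apply: eq_bigr => j _.
by rewrite !ffunE !mulrDr !(addrAC _ (b j * a j)) !subrr.
Qed.

(* [sigma x z] is [X ^ x Z ^ z]. *)
Definition sigma (x z : 'F_2) : 'M[C]_2 :=
  \matrix_(i, j) (((i : 'F_2) == (j : 'F_2) + x)%:R * (-1) ^+ (z * (j : 'F_2))%R).

Lemma F2_cases (x : 'F_2) : x = 0 \/ x = 1.
Proof. by case: x => -[|[|x]] // lt_x; [left|right]; apply/val_inj. Qed.

Lemma sigma00 : sigma 0 0 = pauli_I C.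
Proof. by apply/matrixP => i j; rewrite !mxE addr0 mul0r mulr1. Qed.

Lemma sigma10 : sigma 1 0 = pauli_X C.
Proof.
apply/matrixP => i j; rewrite !mxE mul0r mulr1.
by congr (_%:R); case: (F2_cases i) => ->; case: (F2_cases j) => ->.
Qed.

Lemma sigma01 : sigma 0 1 = pauli_Z C.
Proof.
apply/matrixP => i j; rewrite !mxE addr0 mul1r.
by case: eqP => [->|_] //; rewrite !mul0r.
Qed.

Lemma sigma11 : 'i *: sigma 1 1 = pauli_Y C.
Proof.
congr (_ *: _); apply/matrixP => i j; rewrite !mxE mul1r (bigD1 j) //= big1 => [|k kj].
  rewrite !mxE eqxx mul1r addr0; congr (_%:R * _).
  by case: (F2_cases i) => ->; case: (F2_cases j) => ->.
by rewrite !mxE (negPf kj) mul0r mulr0.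
Qed.

Lemma sigma_pauli (A : 'M[C]_2) :
  A \in [:: pauli_I C; pauli_X C; pauli_Y C; pauli_Z C] ->
  exists r : 'F_2 * 'F_2 * C, `|r.2| = 1 /\ A = r.2 *: sigma r.1.1 r.1.2.
Proof.
rewrite !inE => /or4P[] /eqP ->.
- by exists (0, 0, 1); rewrite normr1 scale1r sigma00.
- by exists (1, 0, 1); rewrite normr1 scale1r sigma10.
- by exists (1, 1, 'i); rewrite normCi sigma11.
- by exists (0, 1, 1); rewrite normr1 scale1r sigma01.
Qed.

Lemma pauli_sigma (x z : 'F_2) : exists p : C,
  `|p| = 1 /\ p *: sigma x z \in [:: pauli_I C; pauli_X C; pauli_Y C; pauli_Z C].
Proof.
case: (F2_cases x) (F2_cases z) => -> [] ->.
- by exists 1; rewrite normr1 scale1r sigma00 !inE eqxx.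
- by exists 1; rewrite normr1 scale1r sigma01 !inE eqxx !orbT.
- by exists 1; rewrite normr1 scale1r sigma10 !inE eqxx !orbT.
- by exists 'i; rewrite normCi sigma11 !inE eqxx !orbT.
Qed.

(** The per-qubit indicators multiply to that of [u = v + a], and the signs to the sign of the
    summed exponents. *)
Lemma tensor_sigma a b (p : 'I_s -> C) :
  tensor (fun j => p j *: sigma (a j) (b j)) =
  phased_op a (\prod_j p j) (fun v => \sum_j b j * v j).
Proof.
apply/matrixP => u v; rewrite !mxE signF2_sum -big_split /=.
under eq_bigr do rewrite !mxE mulrCA.
rewrite big_split /=; congr (_ * _).
case: eqP => [->|/eqP ne_uv].
  by rewrite big1 // => j _; rewrite ffunE eqxx.
have [j ne_j] : exists j, enum_val u j != (enum_val v + a : V) j.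
  apply/existsP; apply: contraNT ne_uv; rewrite negb_exists => /forallP eq_uv.
  by apply/eqP/ffunP => j; have := eq_uv j; rewrite negbK => /eqP.
rewrite (bigD1 j) //=; move: ne_j; rewrite ffunE => /negPf ->.
by rewrite mul0r.
Qed.

(** Replaces the tensor description by one in which level 1 reads as degree at most 1. *)
Lemma pauliP (P : operator C s) : pauli P <->
  exists a w l, [/\ `|w| = 1, deriv_deg_le 1 l & P = phased_op a w l].
Proof.
split=> [[w [A [w1 /(_ _)/sigma_pauli A_pauli ->]]]|[a [w [l [w1 l1 ->]]]]].
  have [r r_prop] := fin_all_exists A_pauli.
  pose a : V := [ffun j => (r j).1.1]; pose b : V := [ffun j => (r j).1.2].
  exists a, (w * \prod_j (r j).2), (fun v => \sum_j b j * v j); split.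
  - by rewrite normrM w1 mul1r normr_prod big1 // => j _; case: (r_prop j).
  - exact: deriv_deg_le1_linear.
  have -> : tensor A = tensor (fun j => (r j).2 *: sigma (a j) (b j)).
    apply/matrixP => u v; rewrite !mxE; apply: eq_bigr => j _.
    by rewrite !ffunE; case: (r_prop j) => _ ->.
  rewrite tensor_sigma; apply/matrixP => u v; rewrite !mxE.
  by rewrite mulrCA !mulrA.
pose b : V := [ffun j => l (bit_unit j) - l 0].
have [p p_prop] := fin_all_exists (fun j => pauli_sigma (a j) (b j)).
have p0 : \prod_j p j != 0.
  by rewrite -normr_eq0 normr_prod big1 ?oner_eq0 // => j _; case: (p_prop j).
(* The global phase absorbs the constant term of [l] and undoes the factors [p j], which turn each
   [sigma] into one of the listed Pauli matrices. *)
exists (w * (-1) ^+ l 0 / \prod_j p j), (fun j => p j *: sigma (a j) (b j)); split.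
- rewrite !normrM w1 normrX normrN1 expr1n !mul1r normfV normr_prod big1 ?invr1 //.
  by move=> j _; case: (p_prop j).
- by move=> j; case: (p_prop j).
rewrite tensor_sigma; apply/matrixP => u v; rewrite !mxE [RHS]mulrCA; congr (_ * _).
have -> : l (enum_val v) = l 0 + \sum_j b j * (enum_val v : V) j.
  rewrite (deriv_deg_le1_affine l1); congr (_ + _).
  by apply: eq_bigr => j _; rewrite [b j]ffunE.
by rewrite mulrA divfK // signF2D mulrA.
Qed.

Lemma pauli_phased_op a w h :
  `|w| = 1 -> pauli (phased_op a w h) <-> deriv_deg_le 1 h.
Proof.
move=> w1; split=> [/pauliP[b [w' [l [w'1 l1 eq_op]]]]|h1]; last first.
  by apply/pauliP; exists a, w, h.
have w0 : w != 0 by rewrite -normr_eq0 w1 oner_eq0.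
have w'0 : w' != 0 by rewrite -normr_eq0 w'1 oner_eq0.
have phi0 v : w * (-1) ^+ h v != 0 by rewrite mulf_neq0 ?signr_eq0.
have [_ eq_hl] := monomial_op_inj phi0 eq_op.
(* [w] and [w'] may differ by a sign, so [h] and [l] agree only up to a constant. *)
have eq_h v : h v = l v + (h 0 - l 0).
  apply/eqP; rewrite addrA -subr_eq opprK; apply/eqP/signF2_inj.
  apply: (mulfI (mulf_neq0 w0 w'0)); rewrite !signF2D mulrACA eq_hl -(eq_hl 0).
  by rewrite mulrACA [w' * w]mulrC.
apply: eq_deriv_deg_le (deriv_deg_leD l1 (deriv_deg_le_cst _ 1 (h 0 - l 0))) => v.
by rewrite -eq_h.
Qed.

(** The exponent is kept as a difference to expose the derivative of [h] in direction [b], although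
    minus is plus in ['F_2]. *)
Lemma conj_phased_op a b w w' h l : `|w| = 1 ->
  phased_op a w h *m phased_op b w' l *m (phased_op a w h)^t* =
  phased_op b w' (fun v => (h (v + a + b) - h (v + a)) + l (v + a)).
Proof.
move=> w1; rewrite adj_monomial_op !mul_monomial_op addrAC addbb add0r.
apply: eq_monomial_op => v.
have -> : - h (v + a) = h (v + a) by case: (F2_cases (h (v + a))) => ->; apply/val_inj.
rewrite !signF2D rmorphM rmorphXn rmorphN1.
set x := (-1) ^+ _; set y := (-1) ^+ _; set z := (-1) ^+ _.
by rewrite -[RHS]mul1r -(expr1n _ 2) -w1 normCK; ring.
Qed.

(** [a] and [w] are general because the induction hypothesis is applied to conjugates of Paulis,
    which have a flip and a phase of their own. *)
Lemma clifford_phased_op t a w h : `|w| = 1 ->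
  clifford_level t.+1 (phased_op a w h) <-> deriv_deg_le t.+1 h.
Proof.
elim: t a w h => [|t IH] a w h w1; first exact: pauli_phased_op.
have unitary : phased_op a w h \is unitarymx.
  by apply: monomial_op_unitary => v; rewrite normrM w1 normrX normrN1 expr1n mulr1.
split=> [[_ h_level] b|ht].
  (* Conjugating the pure bit flip by [b] isolates the derivative of [h]; the translation by [a] is
     then undone. *)
  have b1 : pauli (phased_op b 1 (fun=> 0)).
    by apply/pauliP; exists b, 1, (fun=> 0); split; rewrite ?normr1 //; apply: deriv_deg_le_cst.
  have := h_level _ b1; rewrite conj_phased_op // => /IH; rewrite normr1 => /(_ erefl).
  move=> /(deriv_deg_le_shift a); apply: eq_deriv_deg_le => v.
  by rewrite addbK addr0.
(* The affine exponent [l] leaves the degree bound intact, since [1 <= t.+1]. *)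
split=> // P /pauliP[b [w' [l [w'1 l1 ->]]]]; rewrite conj_phased_op //; apply/IH => //.
apply: deriv_deg_leD; first exact: (@deriv_deg_le_shift _ _ t.+1 _ a (ht b)).
by apply: deriv_deg_le_shift; apply: deriv_deg_le_leq l1.
Qed.

End MonomialOperators.

Lemma phase_gateE (C : numClosedFieldType) (s : nat) (F : fieldExtType 'F_2)
    (alpha : s.-tuple F) (f : F -> 'F_2) :
  phase_gate C alpha f =
  phased_op (0 : {ffun 'I_s -> 'F_2}) 1 (fun v => f (qudit_of_bits alpha v)).
Proof.
apply/matrixP => u v; rewrite !mxE addr0 (inj_eq enum_val_inj) mul1r.
by case: eqP => [->|_]; rewrite ?mul1r ?mul0r.
Qed.

(** * Trace forms as reduced polynomials *)

Section TraceForm.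
Variables (s : nat) (L : finFieldType) (c0 : L) (c : nat -> L).
Hypothesis s_gt0 : (0 < s)%N.
Hypothesis cardL : #|L| = (2 ^ s)%N.
Hypothesis pchar2 : 2%N \in [pchar L].

Let trace_sum (g : L) : L := c0 +
  \sum_(1 <= i < 2 ^ s | coset_leader s i)
    \sum_(k < coset_length s i) (c i * g ^+ i) ^+ (2 ^ k).

Lemma exp2B k : {morph (fun x : L => x ^+ (2 ^ k)) : x y / x - y}.
Proof. elim: k => [|k IH] x y; first by rewrite expn0 !expr1.
by rewrite expnSr !exprM IH -!(pFrobenius_autE pchar2) raddfB. Qed.

(** Scaling by [c i] and raising to the power [2 ^ k] are additive, so the bound for [g ^+ i]
    carries over to each term; terms with [c i = 0] vanish. *)
Lemma deriv_deg_le_trace_sum D :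
  (forall i, (1 <= i < 2 ^ s)%N -> coset_leader s i -> c i != 0 -> (wt i <= D)%N) ->
  deriv_deg_le D trace_sum.
Proof.
move=> wtD; apply: deriv_deg_leD; first exact: deriv_deg_le_cst.
(* The range moves into the predicate, where [deriv_deg_le_sum] offers it as a hypothesis. *)
apply: (eq_deriv_deg_le (f := fun g => \sum_(i <- index_iota 1 (2 ^ s) |
    (1 <= i < 2 ^ s)%N && coset_leader s i)
    \sum_(k < coset_length s i) (c i * g ^+ i) ^+ (2 ^ k))).
  by move=> g; rewrite -big_nat_cond.
apply: deriv_deg_le_sum => i /andP[i_range lead_i].
apply: deriv_deg_le_sum => k _.
apply: (deriv_deg_le_comp (h := fun x : L => x ^+ (2 ^ k))
          (f := fun g : L => c i * g ^+ i)); first exact: exp2B.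
have [->|ci0] := eqVneq (c i) 0.
  apply: eq_deriv_deg_le (deriv_deg_le_cst L D (0 : L)) => g.
  by rewrite mul0r.
apply: (deriv_deg_le_comp (h := *%R (c i)) (f := fun g : L => g ^+ i)).
  by move=> x y; rewrite mulrBr.
exact: deriv_deg_le_leq (wtD i i_range lead_i ci0) (deriv_deg_le_expn pchar2 i).
Qed.

(** Reduced exponents keep the size within [#|L|], so that values determine coefficients. Residues
    are never 0, so each monomial still vanishes at 0. *)
Let trace_poly : {poly L} := c0%:P +
  \sum_(1 <= i < 2 ^ s | coset_leader s i)
    \sum_(k < coset_length s i) (c i ^+ (2 ^ k)) *: 'X^(residue s (2 ^ k * i)).

(** Nonzero [g] satisfy [g ^+ (2 ^ s - 1) = 1]; positive exponents make both sides 0 at [g = 0]. *)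
Lemma expr_eq_mod (g : L) m n : (0 < m)%N -> (0 < n)%N ->
  m = n %[mod 2 ^ s - 1] -> g ^+ m = g ^+ n.
Proof.
move=> m0 n0; have [->|g0] := eqVneq g 0; first by rewrite !expr0n !gtn_eqF.
have gN : g ^+ (2 ^ s - 1) = 1.
  by apply: (mulfI g0); rewrite mulr1 -exprS subn1 prednK ?expn_gt0 // -cardL expf_card.
have gE k : g ^+ k = g ^+ (k %% (2 ^ s - 1)).
  by rewrite {1}(divn_eq k (2 ^ s - 1)) exprD mulnC exprM gN expr1n mul1r.
by move=> eq_mn; rewrite gE eq_mn -gE.
Qed.

Lemma horner_trace_poly g : trace_poly.[g] = trace_sum g.
Proof.
rewrite hornerD hornerC horner_sum; congr (_ + _).
apply: eq_bigr => i lead_i; rewrite horner_sum; apply: eq_bigr => k _.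
rewrite hornerZ hornerXn exprMn -exprM; congr (_ * _).
have i0 : (0 < i)%N by case/and3P: lead_i.
have /andP[r0 _] := residue_bounds s_gt0 (2 ^ k * i).
apply: expr_eq_mod => //; first by rewrite muln_gt0 i0 expn_gt0.
by rewrite mulnC residue_mod.
Qed.

Lemma size_trace_poly : (size trace_poly <= 2 ^ s)%N.
Proof.
have s2 : (1 <= 2 ^ s)%N by rewrite expn_gt0.
apply: leq_trans (size_polyD _ _) _; rewrite geq_max.
rewrite (leq_trans (size_polyC_leq1 _)) //=.
apply: (big_ind (fun p : {poly L} => (size p <= 2 ^ s)%N)) => [|p q Hp Hq|i _].
- by rewrite size_poly0.
- by apply: leq_trans (size_polyD _ _) _; rewrite geq_max Hp.
apply: (big_ind (fun p : {poly L} => (size p <= 2 ^ s)%N)) => [|p q Hp Hq|k _].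
- by rewrite size_poly0.
- by apply: leq_trans (size_polyD _ _) _; rewrite geq_max Hp.
apply: leq_trans (size_scale_leq _ _) _; rewrite size_polyXn.
by case/andP: (residue_bounds s_gt0 (2 ^ k * i)).
Qed.

Lemma coef_trace_poly i : (1 <= i < 2 ^ s)%N -> coset_leader s i -> trace_poly`_i = c i.
Proof.
move=> i_range lead_i; have /andP[i0 lt_i] := i_range.
rewrite coefD coefC gtn_eqF // add0r.
rewrite -big_filter (bigD1_seq i) ?mem_filter ?mem_index_iota ?lead_i //=; last first.
  by rewrite filter_uniq // iota_uniq.
rewrite coefD coef_sum.
have [l0 _ _ _] := coset_lengthP s_gt0 i.
(* The term [k = 0] contributes [c i]; all other exponents differ from [i] by
   [coset_leader_residue]. *)
rewrite (bigD1 (Ordinal l0)) //= mul1n residue_id // expr1 coefZ coefXn eqxx mulr1.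
rewrite big1 ?addr0 => [|k k0]; last first.
  rewrite coefZ coefXn; case: eqP => [|_]; last by rewrite mulr0.
  move=> /esym/(coset_leader_residue s_gt0 lead_i lead_i (ltn_ord k))[_ k_eq0].
  by move: k0; rewrite -val_eqE /= k_eq0.
rewrite coef_sum big1_seq ?addr0 // => i' /andP[ne_i].
rewrite mem_filter => /andP[lead_i' _].
rewrite coef_sum big1 // => k _; rewrite coefZ coefXn.
case: eqP => [|_]; last by rewrite mulr0.
move=> /esym/(coset_leader_residue s_gt0 lead_i lead_i' (ltn_ord k))[eq_i _].
by rewrite eq_i eqxx in ne_i.
Qed.

Lemma deriv_deg_le_trace_sum_wt t i : (1 <= i < 2 ^ s)%N -> coset_leader s i ->
  deriv_deg_le t trace_sum -> c i != 0 -> (wt i <= t)%N.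
Proof.
move=> i_range lead_i deg_t; apply: contraNT; rewrite -ltnNge => lt_t.
rewrite -coef_trace_poly //; apply/eqP; move: lt_t.
apply: (deriv_deg_le_coef0 pchar2); first by rewrite cardL size_trace_poly.
by apply: eq_deriv_deg_le deg_t => g; rewrite horner_trace_poly.
Qed.

End TraceForm.

(** * Transfer between bit strings and the field, and the level of the gate *)

Lemma qudit_of_bitsK (s : nat) (F : fieldExtType 'F_2) (alpha : s.-tuple F) :
  basis_of fullv alpha ->
  cancel (fun g => [ffun j => coord alpha j g]) (qudit_of_bits alpha).
Proof.
move=> alpha_basis g; rewrite /qudit_of_bits [RHS](coord_basis alpha_basis (memvf g)).
by apply: eq_bigr => j _; rewrite ffunE (tnth_nth 0).
Qed.

Lemma qudit_of_bitsD (s : nat) (F : fieldExtType 'F_2) (alpha : s.-tuple F) :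
  {morph (qudit_of_bits alpha : {ffun 'I_s -> 'F_2} -> F) : u v / u + v}.
Proof.
move=> u v; rewrite /qudit_of_bits -big_split /=.
by apply: eq_bigr => j _; rewrite ffunE scalerDl.
Qed.

Local Open Scope complex_scope.

Theorem theorem3p9 (R : realType) (s : nat) (s_ge1 : (1 <= s)%N)
    (F : fieldExtType 'F_2) (cardF : #|{: finvect_type F}| = (2 ^ s)%N)
    (alpha : s.-tuple F) (alpha_basis : basis_of fullv alpha)
    (c0 : 'F_2) (c : nat -> F)
    (c_subfield : forall i, coset_leader s i ->
       in_subfield_2exp (coset_length s i) (c i))
    (c_neq0 : exists2 i, coset_leader s i & c i != 0)
    (f : F -> 'F_2)
    (f_def : forall g : F, (f g)%:A = c0%:A
       + \sum_(1 <= i < 2 ^ s | coset_leader s i)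
           trace2 (coset_length s i) (c i * g ^+ i)) :
  let D := (\max_(1 <= i < 2 ^ s | coset_leader s i && (c i != 0)%R) wt i)%N in
  let U := phase_gate R[i] alpha f in
  clifford_level D U /\
  forall t : nat, (1 <= t < D)%N -> ~ clifford_level t U.
Proof.
move=> D U.
have pchar2 : 2%N \in [pchar finvect_type F] by rewrite (pchar_lalg F) pchar_Fp.
(* The coefficient argument concerns functions from the finite field to itself, so the values of [f]
   are embedded in it. *)
pose emb (x : 'F_2) : finvect_type F := (x%:A : F).
have embB : {morph emb : x y / x - y} by move=> x y; apply: scalerBl.
have embI : injective emb by apply: (fmorph_inj (in_alg F)).
have level_deg t : clifford_level t.+1 U <-> deriv_deg_le t.+1 (emb \o f).
  rewrite /U phase_gateE (clifford_phased_op _ _ _ (normr1 _)).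
  split=> [deg_t|/(deriv_deg_le_comp_inj embB embI) deg_t].
    apply: (deriv_deg_le_comp embB).
    (* Coordinates in the basis [alpha] provide a section of the encoding of labels by bits. *)
    exact: (deriv_deg_le_precomp_surj (@qudit_of_bitsD s F alpha) (qudit_of_bitsK alpha_basis)).
  exact: (deriv_deg_le_precomp (f := f) (@qudit_of_bitsD s F alpha)).
have leader_wt i : (1 <= i < 2 ^ s)%N -> coset_leader s i -> c i != 0 -> (wt i <= D)%N.
  move=> i_range lead_i ci0; rewrite /D.
  by apply: leq_bigmax_seq; rewrite ?mem_index_iota ?lead_i.
have [i lead_i ci0] := c_neq0.
(* [level_deg] covers positive levels only; a nonzero [c i] makes [D] positive. *)
have D_gt0 : (0 < D)%N.
  have /and3P[i0 lt_i _] := lead_i.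
  by apply: leq_trans (wt_gt0 i0) (leader_wt i _ lead_i ci0); rewrite i0.
have degE t : deriv_deg_le t (emb \o f) <->
    deriv_deg_le t (fun g : finvect_type F => c0%:A +
      \sum_(1 <= i < 2 ^ s | coset_leader s i)
        \sum_(k < coset_length s i) (c i * g ^+ i) ^+ (2 ^ k)).
  by split; apply: eq_deriv_deg_le => g; rewrite /= /emb f_def.
split.
  rewrite -(prednK D_gt0) level_deg prednK // degE.
  exact: (@deriv_deg_le_trace_sum s (finvect_type F)).
move=> [//|t] /andP[_ lt_tD] /level_deg/degE deg_t.
(* Degree at most [t.+1] bounds every weight in the maximum by [t.+1], against [t.+1 < D]. *)
move: lt_tD; rewrite ltnNge => /negP; apply.
apply/bigmax_leqP_seq => j; rewrite mem_index_iota => j_range /andP[lead_j cj0].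
exact: (deriv_deg_le_trace_sum_wt s_ge1 cardF pchar2 j_range lead_j deg_t).
Qed.
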